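(* Let $A_C\in\mathbb{R}^{n\times n}$ be a companion matrix with characteristic polynomial $N(s)=\det(sI-A_C)$, and suppose that its spectrum is simple, i.e. it has $n$ distinct eigenvalues $\lambda_1,\dots,\lambda_n\in\mathbb{C}$, with $\lambda_i+\lambda_j\neq 0$ for all $i,j\in\{1,\dots,n\}$. Let $P_C(t)$ be the solution of the differential Lyapunov equation $$-\frac{dP_C(t)}{dt}+A_CP_C(t)+P_C(t)A_C^T=-e_ne_n^T,\qquad P_C(0)=0 .$$ Put $x_i=[1,\lambda_i,\lambda_i^2,\dots,\lambda_i^{n-1}]^T$ and $\mathcal{J}=\mathrm{diag}(-1,(-1)^2,\dots,(-1)^n)$. Then $$P_C(t)=\sum_{i=1}^n\tilde P^C_i(t)=\sum_{i,j=1}^nP^C_{ij}(t),\qquad \tilde P^C_i(t)=\sum_{j=1}^nP^C_{ij}(t),$$ where $$\tilde P^C_i(t)=\left\{-\frac{x_ix_i^T\mathcal{J}}{N'(\lambda_i)N(-\lambda_i)}\left(I-e^{(\lambda_iI+A_C^* )t}\right)\right\}_H,$$ $$P^C_{ij}(t)=\left\{\frac{e^{(\lambda_i+\lambda_j^* )t}-1}{\lambda_i+\lambda_j^*}\cdot\frac{x_ix_j^*}{N'(\lambda_i)N'(\lambda_j^* )}\right\}_H .$$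
   Context: The companion matrix is $A_C=\begin{bmatrix}0_{(n-1)\times 1}&I_{(n-1)\times(n-1)}\\-a_0&-a_1\ \cdots\ -a_{n-1}\end{bmatrix}$ (ones on the superdiagonal, last row $(-a_0,\dots,-a_{n-1})$, zeros elsewhere) with real $a_0,\dots,a_{n-1}$, so that $N(s)=\det(sI-A_C)=\sum_{k=0}^na_ks^k$ with $a_n=1$; $N'$ is the derivative of $N$. The vector $e_n=[0,\dots,0,1]^T$ is the last column of the identity matrix. $(\cdot)^*$ denotes the complex conjugate (transpose), in particular $\lambda^*$ is the complex conjugate of the scalar $\lambda$. $\{M\}_H=\tfrac12(M+M^* )$ is the Hermitian part of a square matrix $M$. No stability of $A_C$ is assumed. *)

(* Defs.v *)
From HB Require Import structures.
From mathcomp Require Import all_boot all_order all_algebra.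
From mathcomp Require Import complex.
From mathcomp Require Import all_classical all_reals all_analysis.
Set Implicit Arguments.
Unset Strict Implicit.
Unset Printing Implicit Defensive.
Import Order.TTheory GRing.Theory Num.Theory.
Import numFieldNormedType.Exports.
Local Open Scope classical_set_scope.
Local Open Scope ring_scope.

Definition mxC (R : realType) (m n : nat) (M : 'M[R]_(m, n)) : 'M[R[i]]_(m, n) :=
  map_mx (real_complex R) M.

Definition ctrmx (R : realType) (m n : nat) (M : 'M[R[i]]_(m, n)) : 'M[R[i]]_(n, m) :=
  map_mx Num.conj M^T.

Definition herm_part (R : realType) (n : nat) (M : 'M[R[i]]_n) : 'M[R[i]]_n :=
  2^-1 *: (M + ctrmx M).

(* Over a numFieldType K, which carries its norm topology as a canonical
   instance whereas R[i] itself does not; both are used with K := R[i]. *)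
Definition expK (K : numFieldType) (z : K) : K :=
  limn (series (fun k : nat => z ^+ k / k`!%:R)).

Definition expmx (K : numFieldType) (n : nat) (M : 'M[K]_n.+1) : 'M[K]_n.+1 :=
  limn (series (fun k : nat => (k`!%:R)^-1 *: M ^+ k)).

(* The last row is (- a_0, ..., - a_n): the size is n.+1, so that the dimension
   ranges over the positive integers. *)
Definition companion (R : realType) (n : nat) (a : 'I_n.+1 -> R) : 'M[R]_n.+1 :=
  \matrix_(i, j) if i == ord_max then - a j else (j == i.+1 :> nat)%:R.

Definition e_last (R : realType) (n : nat) : 'cV[R]_n.+1 := delta_mx ord_max 0.

(* A solution on an arbitrary time interval I (e.g. `[0, +oo[, `[0, T] or
   `]-oo, +oo[): continuous on I, with the equation holding in the interior;
   this includes the solutions with one-sided derivatives at the endpoints. *)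
Definition solves_DLE (R : realType) (n : nat) (A : 'M[R]_n.+1) (b : 'cV[R]_n.+1)
    (I : interval R) (P : R -> 'M[R]_n.+1) : Prop :=
  [/\ P 0 = 0,
      {within [set` I], continuous P} &
      forall t : R, [set` I]° t ->
        derivable P t 1 /\
        - 'D_1 P t + A *m P t + P t *m A^T = - (b *m b^T)].

Definition evec (R : realType) (n : nat) (z : R[i]) : 'cV[R[i]]_n.+1 :=
  \col_(k < n.+1) z ^+ k.

(* Indices start at 0, hence the exponent k.+1 in diag(-1, (-1)^2, ...). *)
Definition Jmx (R : realType) (n : nat) : 'M[R[i]]_n.+1 :=
  diag_mx (\row_(k < n.+1) (-1) ^+ k.+1).

Definition Ptilde (R : realType) (n : nat) (a : 'I_n.+1 -> R)
    (lambda : 'I_n.+1 -> R[i]) (i : 'I_n.+1) (t : R) : 'M[R[i]]_n.+1 :=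
  let AC := mxC (companion a) in
  let N := char_poly AC in
  let x := evec n (lambda i) in
  herm_part
    (- (((N^`()).[lambda i] * N.[- lambda i])^-1 *: (x *m x^T *m Jmx R n))
     *m (1%:M - expmx (real_complex R t *: ((lambda i)%:M + ctrmx AC)))).

Definition Pij (R : realType) (n : nat) (a : 'I_n.+1 -> R)
    (lambda : 'I_n.+1 -> R[i]) (i j : 'I_n.+1) (t : R) : 'M[R[i]]_n.+1 :=
  let N := char_poly (mxC (companion a)) in
  let s := lambda i + Num.conj (lambda j) in
  herm_part
    (((expK (s * real_complex R t) - 1) / s) *:
     (((N^`()).[lambda i] * (N^`()).[Num.conj (lambda j)])^-1 *:
      (evec n (lambda i) *m ctrmx (evec n (lambda j))))).

(* Main.v *)
Require Import Defs.
From HB Require Import structures.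
From mathcomp Require Import all_boot all_order all_algebra.
From mathcomp Require Import complex.
From mathcomp Require Import all_classical all_reals all_analysis.
From mathcomp Require Import ring.
Set Implicit Arguments.
Unset Strict Implicit.
Unset Printing Implicit Defensive.
Import Order.TTheory GRing.Theory Num.Theory.
Import numFieldNormedType.Exports.
Local Open Scope classical_set_scope.
Local Open Scope ring_scope.

(** The columns [x i = evec n (lambda i)] are right eigenvectors of the companion
    matrix [AC] ([companion_evec]) and form an invertible Vandermonde matrix [X].
    In the basis of the [x i] the vector [e_last] has coordinates
    [1 / N'(lambda i)] ([evec_mx_residues]): this is Lagrange interpolation of
    the monomials at the roots of [N], read off on leading coefficients.

    Put [Y = X^-1] and [G t = Y *m P t *m Y^*]. The Lyapunov equation becomes
    diagonal: each entry of [G] satisfies [g' = s g + c] with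
    [s = lambda i + conj (lambda j)], [c = 1 / (N'(lambda i) conj (N'(lambda j)))]
    and [g 0 = 0]. The spectrum of the real matrix [AC] is closed under
    conjugation, so [s] is nonzero and [g t = c (e^(s t) - 1) / s]
    ([affine_ode]); here the uniqueness holds on any interval because
    [|d|^2 e^(- 2 Re s t)] is constant for the difference [d] of two solutions.
    Expanding [P t = X *m G t *m X^*] gives the double sum ([DLE_modes]). Its terms
    are exchanged in pairs by conjugate transposition, so that replacing each by
    its Hermitian part preserves the sum ([sum_Pij_modal_term]).

    For a fixed [i], the sum over [j] is identified with [Ptilde i] termwise
    ([Ptilde_sum]): the partial fraction expansion of [s^k / N(s)] over the roots
    [conj (lambda j)], taken at [s = - lambda i], writes the row
    [x_i^T J / N(- lambda i)] as a combination of the rows [x_j^*]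
    ([residue_row]), on which the matrix exponential acts by scalars
    ([expmx_diag]).

    The complex exponential is handled through the real power series of
    [Re (w e^(s t))] in [t], which converge, and are differentiated, as real power
    series ([is_derive_re_exp], [expK_line]). *)

(** * Exponential series over a normed field *)

(** Over [R[i]] the norm topology is reached only through the generic
    [numFieldType] instance, so convergence there is named over an arbitrary [K]
    and then instantiated. *)
Definition cvg_expK (K : numFieldType) (z : K) : Prop :=
  cvgn (series (fun k : nat => z ^+ k / k`!%:R)).

(** Elementary epsilon form of convergence of the exponential series: it lets
    the complex case be settled by estimates on real and imaginary parts. *)
Lemma expK_eps (K : numFieldType) (z l : K) :
    (forall e : K, 0 < e -> exists N, forall n, (N <= n)%N ->
       `|l - \sum_(0 <= k < n) z ^+ k / k`!%:R| < e) ->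
  cvg_expK z /\ expK z = l.
Proof.
move=> zl.
have cvg_l : series (fun k : nat => z ^+ k / k`!%:R) @ \oo --> l.
  by apply/cvgrPdist_lt => e /zl[N HN]; exists N => // n /= Nn; exact: HN.
split; first by apply/cvg_ex; exists l.
exact: cvg_lim cvg_l.
Qed.

Lemma cvg_mx_entry (K : numFieldType) (m n : nat) (u : nat -> 'M[K]_(m, n))
    (M : 'M[K]_(m, n)) :
  (forall i j, (fun k => u k i j) @ \oo --> M i j) -> u @ \oo --> M.
Proof.
move=> uM; apply/cvg_mx_entourageP => A entA.
suff : \forall k \near \oo, forall i j, (M i j, u k i j) \in A by [].
apply: (@filter_forall _ _ (fun i k => forall j, (M i j, u k i j) \in A)) => i.
apply: (@filter_forall _ _ (fun j k => (M i j, u k i j) \in A)) => j.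
have uMij : \forall k \near \oo, A (M i j, u k i j).
  exact: (cvg_entourage (uM i j)).
by apply: filterS uMij => k /=; rewrite inE.
Qed.

(** If the rows of [V] are left eigenvectors of [M], the partial sums of the
    matrix exponential are [V^-1 *m D *m V] with [D] the diagonal of the scalar
    partial sums, so each entry is a fixed linear combination of convergent
    scalar series. *)
Lemma expmx_diag (K : numFieldType) (n : nat) (V M : 'M[K]_n.+1)
    (d : 'I_n.+1 -> K) :
    V \in unitmx -> V *m M = diag_mx (\row_j d j) *m V ->
    (forall j, cvg_expK (d j)) ->
  V *m expmx M = diag_mx (\row_j expK (d j)) *m V.
Proof.
move=> Vu VM cvg_d.
have VX k : V *m M ^+ k = diag_mx (\row_j d j ^+ k) *m V.
  elim: k => [|k IHk].
    rewrite expr0 mulmx1; apply/matrixP => i j.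
    by rewrite mul_diag_mx !mxE expr0 mul1r.
  rewrite exprS -mulmxE mulmxA VM -mulmxA IHk mulmxA; congr (_ *m _).
  by apply/matrixP => i j; rewrite mul_diag_mx !mxE exprS mulrnAr.
have MX k : M ^+ k = invmx V *m (diag_mx (\row_j d j ^+ k) *m V).
  by rewrite -VX mulKmx.
rewrite -[RHS](mulKVmx Vu); congr (_ *m _); rewrite /expmx.
apply: (@cvg_lim _ (@norm_hausdorff _ _)); apply: cvg_mx_entry => i j.
rewrite mulmxA mxE.
have -> : (fun k => series (fun k0 => k0`!%:R^-1 *: M ^+ k0) k i j) =
  (fun k => \sum_l invmx V i l *
     (series (fun k0 => d l ^+ k0 / k0`!%:R) k * V l j)).
  apply/funext => N; rewrite /series /= summxE.
  under [RHS]eq_bigr do rewrite mulr_suml mulr_sumr.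
  rewrite exchange_big /=; apply: eq_bigr => k _.
  rewrite MX !mxE mulr_sumr; apply: eq_bigr => l _.
  by rewrite mul_diag_mx !mxE; ring.
have -> : \sum_k (invmx V *m diag_mx (\row_j0 expK (d j0))) i k * V k j =
    \sum_l invmx V i l * (expK (d l) * V l j).
  by apply: eq_bigr => l _; rewrite mul_mx_diag !mxE mulrA.
apply: cvg_big => [|l _]; first exact: add_continuous.
 apply: cvgMr; apply: cvgMl; exact: cvg_d.
Qed.

(** * The complex exponential along a real line *)

Section ComplexExponential.
Variable R : realType.
Implicit Types (w s z : R[i]) (t : R).
Local Notation Re := complex.Re.
Local Notation Im := complex.Im.
Local Notation toC := (real_complex R).

Lemma Re_add z w : Re (z + w) = Re z + Re w. Proof. by case: z w => ? ? []. Qed.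
Lemma Re_sub z w : Re (z - w) = Re z - Re w. Proof. by case: z w => ? ? []. Qed.
Lemma Re_mul z w : Re (z * w) = Re z * Re w - Im z * Im w.
Proof. by case: z w => ? ? []. Qed.
Lemma Re_mul_real z t : Re (z * toC t) = Re z * t.
Proof. by rewrite Re_mul /= mulr0 subr0. Qed.
Lemma Re_sum (I : Type) (r : seq I) (F : I -> R[i]) :
  Re (\sum_(i <- r) F i) = \sum_(i <- r) Re (F i).
Proof.
have Re0 : Re (0 : R[i]) = 0 by [].
exact: (big_morph (fun z : R[i] => Re z) Re_add Re0).
Qed.
Lemma Im_Re z : Im z = Re (- 'i%C * z).
Proof. by case: z => a b; simpc. Qed.

Lemma normr_Re_le z : `|Re z| <= Re `|z|.
Proof. by have := normc_ge_Re z; rewrite lecE => /andP[]. Qed.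

Definition re_coef w s : R^nat := fun k => Re (w * s ^+ k) / k`!%:R.

(** This is [Re (w * e^(s t))] written as a real power series in [t]; the weight
    [w] makes the family stable under differentiation (which replaces [w] by
    [w * s]), and the weight [- 'i] yields the imaginary part. *)
Definition re_exp w s t : R := limn (pseries (re_coef w s) t).

(** The series is dominated by the real exponential series of [|s| * |t|],
    scaled by [|w|]. *)
Lemma cvg_re_coef w s t : cvgn (pseries (re_coef w s) t).
Proof.
apply: normed_cvg.
have toC_norm z : `|z| = toC (Re `|z|) by rewrite normc_def.
apply: (@series_le_cvg _ _ (fun k => Re `|w| * exp_coeff (Re `|s| * `|t|) k)).
- by move=> k; exact: normr_ge0.
- move=> k; rewrite mulr_ge0 ?exp_coeff_ge0 ?mulr_ge0 //.
    exact: le_trans (normr_Re_le _).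
  exact: le_trans (normr_Re_le _).
- move=> k; rewrite /exp_coeff /= /re_coef !normrM normfV normrX.
  rewrite (ger0_norm (ler0n _ _)) exprMn.
  have : `|Re (w * s ^+ k)| <= Re `|w| * Re `|s| ^+ k.
    apply: le_trans (normr_Re_le _) _.
    rewrite normrM normrX (toC_norm w) (toC_norm s) -rmorphXn -rmorphM.
    exact: lexx.
  move=> le_wsk; rewrite mulrAC !mulrA ler_wpM2r ?invr_ge0 ?ler0n //.
  by rewrite ler_wpM2r ?exprn_ge0.
- exact: (@is_cvg_seriesZ _ _ (Re `|w|) (is_cvg_series_exp_coeff _)).
Qed.

Lemma pseries_diffs_re_coef w s :
  pseries_diffs (re_coef w s) = re_coef (w * s) s.
Proof.
apply/funext => k; rewrite /pseries_diffs /re_coef factS natrM invfM exprS mulrA.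
by rewrite mulrCA; congr (_ * _); rewrite mulVKf // pnatr_eq0.
Qed.

Lemma is_derive_re_exp w s t :
  is_derive t 1 (re_exp w s) (re_exp (w * s) s t).
Proof.
have t_lt : `|t| < `| `|t| + 1| by rewrite [ltRHS]ger0_norm ?ltrDl ?addr_ge0.
have := @pseries_snd_diffs R (re_coef w s) (`|t| + 1) t.
rewrite !pseries_diffs_re_coef; apply => //; exact: cvg_re_coef.
Qed.

Lemma re_exp_lin w s t :
  re_exp w s t = Re w * re_exp 1 s t - Im w * re_exp (- 'i%C) s t.
Proof.
apply: cvg_lim => //.
have -> : pseries (re_coef w s) t = (fun n => Re w * pseries (re_coef 1 s) t n -
    Im w * pseries (re_coef (- 'i%C) s) t n).
  apply/funext => n; rewrite /pseries /series /= !mulr_sumr -sumrB.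
  apply: eq_bigr => k _; rewrite /re_coef mul1r -Im_Re Re_mul; ring.
by apply: cvgB; apply: cvgMr; exact: cvg_re_coef.
Qed.

(** The real and imaginary parts of the partial sums are the real partial sums
    with weights [1] and [- 'i], so complex convergence follows from
    [|z| <= |Re z| + |Im z|]. *)
Lemma expK_line s t : cvg_expK (s * toC t) /\
  expK (s * toC t) = Complex (re_exp 1 s t) (re_exp (- 'i%C) s t).
Proof.
apply: expK_eps => e e_gt0.
(* A positive complex number is real, so [e] is controlled by [Re e]. *)
have e_re : e = toC (Re e).
  by move: e_gt0; rewrite ltcE /=; case: e => a b /= /andP[/eqP-> _].
have {}e_gt0 : 0 < Re e by move: e_gt0; rewrite ltcE => /andP[].
have cvg_w w : exists N, forall n, (N <= n)%N ->
    `|re_exp w s t - pseries (re_coef w s) t n| < Re e / 2.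
  have := @cvg_re_coef w s t => /cvgrPdist_lt /(_ (Re e / 2)).
  by rewrite divr_gt0 // => /(_ isT)[N _ HN]; exists N => n /HN.
have [N1 H1] := cvg_w 1; have [N2 H2] := cvg_w (- 'i%C).
exists (maxn N1 N2) => n; rewrite geq_max => /andP[/H1 {}H1 /H2 {}H2].
have SE w : Re (w * (\sum_(0 <= k < n) (s * toC t) ^+ k / k`!%:R)) =
    pseries (re_coef w s) t n.
  rewrite mulr_sumr Re_sum /pseries /series /=; apply: eq_bigr => k _.
  rewrite /re_coef exprMn -rmorphXn -[k`!%:R in LHS](rmorph_nat toC) -fmorphV.
  by rewrite !mulrA !Re_mul_real; ring.
set S := \sum_(0 <= k < n) _ in SE *.
rewrite e_re (complexE (_ - S)); apply: le_lt_trans (ler_normD _ _) _.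
have -> : Re (Complex (re_exp 1 s t) (re_exp (- 'i%C) s t) - S) =
    re_exp 1 s t - pseries (re_coef 1 s) t n by rewrite -SE mul1r Re_sub.
have -> : Im (Complex (re_exp 1 s t) (re_exp (- 'i%C) s t) - S) =
    re_exp (- 'i%C) s t - pseries (re_coef (- 'i%C) s) t n.
  by rewrite -SE -Im_Re; case: (S).
have norm_toC x : `|toC x| = toC `|x|.
  by rewrite normc_def /= expr0n addr0 sqrtr_sqr.
rewrite normrM !norm_toC.
have -> : `|'i%C : R[i]| = 1.
  by rewrite normc_def /= expr0n expr1n add0r sqrtr1.
by rewrite mul1r -rmorphD ltcR [Re e]splitr ltrD.
Qed.

Lemma Re_expK w s t : Re (w * expK (s * toC t)) = re_exp w s t.
Proof. by rewrite (expK_line s t).2 Re_mul /= -re_exp_lin. Qed.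

Lemma expK_line0 s : expK (s * toC 0) = 1.
Proof.
apply: (proj2 (expK_eps _)) => e e_gt0; exists 1%N => -[//|n] _.
rewrite mulr0 big_nat_recl // big1 ?addr0.
  by rewrite expr0 fact0 divr1 subrr normr0.
by move=> k _; rewrite exprS mul0r mul0r.
Qed.

Lemma conj_expK_line s t :
  Num.conj (expK (s * toC t)) = expK (Num.conj s * toC t).
Proof.
have conjE z : Num.conj z = Complex (Re z) (- Im z) by case: z.
have conjX k : Num.conj s ^+ k = Complex (Re (s ^+ k)) (- Im (s ^+ k)).
  by rewrite -conjE rmorphXn.
have coef1 : re_coef 1 (Num.conj s) = re_coef 1 s.
  by apply/funext => k; rewrite /re_coef !mul1r conjX.
have coefi : re_coef (- 'i%C) (Num.conj s) = - re_coef (- 'i%C) s.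
  apply/funext => k; rewrite fctE /re_coef -!Im_Re conjX /=.
  by rewrite mulNr.
rewrite !(expK_line _ t).2 conjE /=; congr Complex.
  by rewrite /re_exp coef1.
rewrite /re_exp coefi; apply/esym/cvg_lim => //.
have -> : pseries (- re_coef (- 'i%C) s) t = - pseries (re_coef (- 'i%C) s) t.
  apply/funext => n; transitivity (- pseries (re_coef (- 'i%C) s) t n) => //.
  rewrite /pseries /series /= -sumrN.
  by apply: eq_bigr => k _; rewrite mulNr.
by apply: cvgN; exact: cvg_re_coef.
Qed.

End ComplexExponential.

(** * Scalar linear differential equations with complex coefficients *)

Section ScalarODE.
Variable R : realType.
Implicit Types (w s z c : R[i]) (t : R) (f g : R -> R[i]).
Local Notation Re := complex.Re.
Local Notation Im := complex.Im.
Local Notation toC := (real_complex R).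

(** Differentiability of a complex-valued function of a real variable, tested
    against every real-linear functional [z |-> Re (w * z)] of the plane; in this
    form multiplication by a complex constant is absorbed into [w]. *)
Definition is_cderive f t z :=
  forall w, is_derive t (1 : R) (fun x => Re (w * f x)) (Re (w * z)).

Definition cwithin (A : set R) f :=
  forall w, {within A, continuous (fun x => Re (w * f x))}.

Lemma is_cderiveB f g t z w :
    is_cderive f t z -> is_cderive g t w ->
  is_cderive (fun x => f x - g x) t (z - w).
Proof.
move=> df dg u; rewrite mulrBr Re_sub.
rewrite (_ : (fun x => _) = (fun x => Re (u * f x)) - (fun x => Re (u * g x))).
  exact: is_deriveB.
by apply/funext => x; rewrite mulrBr Re_sub.
Qed.

Lemma is_cderiveZ f t z w :
  is_cderive f t z -> is_cderive (fun x => w * f x) t (w * z).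
Proof.
move=> df u; rewrite mulrA; under eq_fun do rewrite mulrA; exact: df.
Qed.

Lemma is_cderive_cst t z : is_cderive (fun=> z) t 0.
Proof. by move=> w; rewrite mulr0; exact: is_derive_cst. Qed.

Lemma is_cderive_expK s t :
  is_cderive (fun x => expK (s * toC x)) t (s * expK (s * toC t)).
Proof.
move=> w; rewrite mulrA Re_expK; under eq_fun do rewrite Re_expK.
exact: is_derive_re_exp.
Qed.

Lemma is_cderive_cont f : (forall t, exists z, is_cderive f t z) ->
  forall A, cwithin A f.
Proof.
move=> df A w; apply: continuous_subspaceT => t.
have [z dz] := df t; have [dvb _] := dz w.
exact/differentiable_continuous/derivable1_diffP.
Qed.

Lemma cwithinB (A : set R) f g :
  cwithin A f -> cwithin A g -> cwithin A (fun x => f x - g x).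
Proof.
move=> cf cg w; under eq_fun do rewrite mulrBr Re_sub.
exact: within_continuousB.
Qed.

Lemma derive0_cst_itv (I : interval R) (h : R -> R) :
    {within [set` I], continuous h} ->
    (forall x, [set` I]° x -> is_derive x (1 : R) h 0) ->
  {in I &, forall x y, h x = h y}.
Proof.
move=> ch dh x y xI yI; wlog xy : x y xI yI / x <= y => [hwlog|].
  by have [/hwlog ->//|/ltW/hwlog ->] := leP x y.
have xyI : `[x, y]%classic `<=` [set` I].
  move=> z /= zxy; apply: (subitvP _ zxy); move: xI yI.
  case: I {ch dh} => l u; rewrite !itv_boundlr => /andP[? _] /andP[_ ?].
  exact/andP.
have xyI_int : `]x, y[%classic `<=` [set` I]°.
  rewrite -open_subsetE; last exact: interval_open.
  by apply: subset_trans xyI; exact: subset_itv_oo_cc.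
have [||c _] := @MVT_segment R h (fun=> 0) x y xy.
- by move=> z zxy; apply: dh; exact: xyI_int.
- exact: continuous_subspaceW ch.
- by rewrite mul0r => /eqP; rewrite subr_eq0 => /eqP ->.
Qed.

(** For [d' = s * d] the squared modulus satisfies [(|d|^2)' = 2 Re s |d|^2], so
    [|d|^2 * exp (- 2 Re s t)] is constant, and it vanishes at 0. *)
Lemma homogeneous_ode_unique (I : interval R) (d : R -> R[i]) s :
    0 \in I -> d 0 = 0 -> cwithin [set` I] d ->
    (forall x, [set` I]° x -> is_cderive d x (s * d x)) ->
  {in I, forall t, d t = 0}.
Proof.
move=> I0 d0 cd dd t It.
(* The weights [1] and [- 'i] extract the real and imaginary parts of [d]. *)
pose h x := (Re (1 * d x) ^+ 2 + Re (- 'i%C * d x) ^+ 2) *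
  expR (- (Re s *+ 2) * x).
have h0 : h t = h 0.
  apply: (@derive0_cst_itv I) => //.
  - move=> x; apply: cvgM; first by apply: cvgD; apply: cvgM; exact: cd.
    apply: continuous_subspaceT => {}x; apply: continuous_comp.
      exact: mulrl_continuous.
    exact: continuous_expR.
  - move=> x Ix; rewrite /h.
    have d1 := dd x Ix 1; have d2 := dd x Ix (- 'i%C).
    have de : is_derive x (1 : R) (fun x => expR (- (Re s *+ 2) * x))
        (- (Re s *+ 2) * expR (- (Re s *+ 2) * x)).
      apply: is_derive_eq; rewrite /GRing.scale /=; ring.
    apply: is_derive_eq.
    rewrite /GRing.scale /= -!Im_Re !mul1r Re_mul.
    have -> : Im (s * d x) = Re s * Im (d x) + Im s * Re (d x).
      by case: (s) (d x) => ? ? [].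
    ring.
move: h0; rewrite /h d0 !mulr0 /= expr0n addr0 mul0r => /eqP.
rewrite mulf_eq0 (gt_eqF (expR_gt0 _)) orbF paddr_eq0 ?sqr_ge0 //.
rewrite !sqrf_eq0 -Im_Re mul1r => /andP[/eqP Re0 /eqP Im0]; apply/eqP.
by rewrite eq_complex Re0 Im0 !eqxx.
Qed.

Lemma affine_ode (I : interval R) (p : R -> R[i]) s c :
    s != 0 -> 0 \in I -> p 0 = 0 -> cwithin [set` I] p ->
    (forall x, [set` I]° x -> is_cderive p x (s * p x + c)) ->
  {in I, forall t, p t = (expK (s * toC t) - 1) / s * c}.
Proof.
move=> s0 I0 p0 cp dp t It.
pose q x := c / s * (expK (s * toC x) - 1).
have dq x : is_cderive q x (s * q x + c).
  have -> : s * q x + c = c / s * (s * expK (s * toC x) - 0).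
    by rewrite /q; field.
  apply: is_cderiveZ; apply: is_cderiveB; first exact: is_cderive_expK.
  exact: is_cderive_cst.
have := @homogeneous_ode_unique I (fun x => p x - q x) s I0 _ _ _ t It.
rewrite /q expK_line0 subrr mulr0 p0 subr0 => /(_ erefl) pq.
rewrite -[LHS](subrK (q t)) pq /q; first by field.
- by apply: cwithinB => //; apply: is_cderive_cont => x; exists (s * q x + c).
- move=> x Ix.
  have -> : s * (p x - q x) = (s * p x + c) - (s * q x + c) by ring.
  by apply: is_cderiveB => //; exact: dp.
Qed.

End ScalarODE.

(** * Lagrange interpolation at the roots and partial fractions *)

Section PartialFractions.
Variables (F : fieldType) (n : nat) (mu : 'I_n.+1 -> F).
Hypothesis mu_inj : injective mu.
Local Notation cofac i := (\prod_(j < n.+1 | j != i) ('X - (mu j)%:P)).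
Local Notation N := (\prod_(j < n.+1) ('X - (mu j)%:P)).

Lemma cofac_monic i : cofac i \is monic.
Proof. by apply: monic_prod => j _; exact: monicXsubC. Qed.


Lemma prod_cofac i : N = ('X - (mu i)%:P) * cofac i.
Proof. by rewrite (bigD1 i). Qed.

Lemma size_cofac i : size (cofac i) = n.+1.
Proof.
have := size_prod_XsubC (enum 'I_n.+1) mu; rewrite big_enum /=.
rewrite (prod_cofac i) size_proper_mul ?lead_coefXsubC ?mul1r; last first.
  by rewrite lead_coef_eq0 monic_neq0 // cofac_monic.
by rewrite size_XsubC size_enum_ord /= => -[].
Qed.

Lemma deriv_prod_root i : N^`().[mu i] = (cofac i).[mu i].
Proof.
rewrite (prod_cofac i) derivM derivXsubC mul1r hornerD hornerM hornerXsubC.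
by rewrite subrr mul0r addr0.
Qed.

Lemma cofac_root i j : j != i -> (cofac i).[mu j] = 0.
Proof. by move=> ji; rewrite (bigD1 j) //= hornerM hornerXsubC subrr mul0r. Qed.

Lemma deriv_prod_neq0 i : N^`().[mu i] != 0.
Proof.
rewrite deriv_prod_root horner_prod prodf_seq_neq0.
apply/allP => j _; apply/implyP => ji.
by rewrite hornerXsubC subr_eq0 (inj_eq mu_inj) eq_sym.
Qed.

(** Both sides have degree at most [n] and agree at the [n.+1] points [mu i]. The
    normalising constant of the [i]-th basis polynomial is [N'(mu i)]. *)
Lemma lagrange_interpolation (q : {poly F}) : (size q <= n.+1)%N ->
  q = \sum_i (q.[mu i] / N^`().[mu i]) *: cofac i.
Proof.
move=> sq; apply/eqP; rewrite -subr_eq0; apply/eqP.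
apply: (@roots_geq_poly_eq0 _ _ [seq mu i | i <- enum 'I_n.+1]).
- apply/allP => _ /mapP[i _ ->]; rewrite rootE hornerD hornerN horner_sum.
  rewrite [X in _ - X](bigD1 i) //= [X in _ - (_ + X)]big1 => [|j ji]; last first.
    by rewrite hornerZ cofac_root 1?eq_sym // mulr0.
  rewrite addr0 hornerZ -deriv_prod_root divfK ?subrr //.
  exact: deriv_prod_neq0.
- by rewrite map_inj_uniq // enum_uniq.
- rewrite size_map size_enum_ord (leq_trans (size_polyD _ _)) //.
  rewrite size_polyN geq_max sq.
  rewrite (leq_trans (size_sum _ _ _)) //; apply/bigmax_leqP => i _.
  by rewrite (leq_trans (size_scale_leq _ _)) // size_cofac.
Qed.

Lemma partial_fractions (q : {poly F}) z : (size q <= n.+1)%N -> N.[z] != 0 ->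
  q.[z] / N.[z] = \sum_i q.[mu i] / (N^`().[mu i] * (z - mu i)).
Proof.
move=> sq Nz; rewrite {1}(lagrange_interpolation sq) horner_sum mulr_suml.
apply: eq_bigr => i _; have := deriv_prod_neq0 i; move: Nz.
rewrite hornerZ; set d := N^`().[_]; rewrite (prod_cofac i) hornerM hornerXsubC.
rewrite mulf_eq0 negb_or => /andP[zi cz] d0; field.
by rewrite zi cz d0.
Qed.

(** Comparison of the coefficients of ['X^n] in the interpolation of ['X^k]. *)
Lemma sum_roots_deriv (k : 'I_n.+1) :
  \sum_i mu i ^+ k / N^`().[mu i] = (k == ord_max)%:R.
Proof.
have /lagrange_interpolation : (size ('X^k : {poly F}) <= n.+1)%N.
  by rewrite size_polyXn.
move/(congr1 (fun p : {poly F} => p`_n)); rewrite coefXn coef_sum eq_sym.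
have -> : (k == n :> nat) = (k == ord_max) by [].
move=> ->; apply: eq_bigr => i _; rewrite coefZ hornerXn.
have := monicP (cofac_monic i); rewrite /lead_coef size_cofac /= => ->.
by rewrite mulr1.
Qed.

End PartialFractions.

(** * Spectral decomposition of a companion matrix *)

Lemma eigenvalue_trmx (F : fieldType) (n : nat) (A : 'M[F]_n) z :
  eigenvalue A^T z = eigenvalue A z.
Proof.
rewrite !eigenvalue_root_char /char_poly -det_tr /char_poly_mx.
by rewrite linearB /= tr_scalar_mx map_trmx trmxK.
Qed.

Section CompanionSpectrum.
Variables (R : realType) (n : nat) (a : 'I_n.+1 -> R).
Local Notation AC := (mxC (companion a)).

(** A left eigenvalue is also a right one. The first rows of [AC] shift the
    coordinates, so the coordinates of a right eigenvector for [z] form a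
    geometric progression of ratio [z]: it is a multiple of [evec n z]. *)
Lemma companion_evec z : eigenvalue AC z -> AC *m evec n z = z *: evec n z.
Proof.
rewrite -eigenvalue_trmx => /eigenvalueP[v vA v_neq0].
have {}vA : AC *m v^T = z *: v^T by rewrite -[AC]trmxK -trmx_mul vA linearZ.
have v_step (i j : 'I_n.+1) : j = i.+1 :> nat -> v 0 j = z * v 0 i.
  move=> ij; have /matrixP/(_ i 0) := vA; rewrite !mxE => <-.
  have i_neq : (i == ord_max) = false.
    by apply/negbTE; rewrite neq_ltn -ltnS -ij ltn_ord.
  rewrite (bigD1 j) //= big1 => [|k kj]; rewrite !mxE i_neq.
    by rewrite ij eqxx addr0 rmorph1 mul1r.
  by rewrite -ij (inj_eq val_inj) (negbTE kj) rmorph0 mul0r.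
have vE (i : 'I_n.+1) : v 0 i = v 0 0 * z ^+ i.
  case: i => i; elim: i => [|i IHi] lt_i.
    by rewrite expr0 mulr1; congr (v 0 _); apply: val_inj.
  rewrite (@v_step (Ordinal (ltnW lt_i))) // IHi /= exprS; exact: mulrCA.
have v0 : v 0 0 != 0.
  apply: contra_neq v_neq0 => v00; apply/rowP => i.
  by rewrite vE v00 mul0r mxE.
have vevec : v^T = v 0 0 *: evec n z.
  by apply/colP => i; rewrite mxE vE !mxE.
apply: (scalerI v0); rewrite scalerA mulrC -scalerA -vevec -vA vevec.
by rewrite -scalemxAr.
Qed.

Lemma eigenvalue_conj z : eigenvalue AC z -> eigenvalue AC (Num.conj z).
Proof.
rewrite !eigenvalue_root_char -(map_char_poly (real_complex R)) /root.
(* The characteristic polynomial has real coefficients. *)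
rewrite -[in X in _ -> X](_ : map_poly Num.conj (map_poly (real_complex R)
   (char_poly (companion a))) = map_poly (real_complex R) (char_poly (companion a))).
  by rewrite horner_map fmorph_eq0.
by apply/polyP => i; rewrite !coef_map; exact: conjc_real.
Qed.

Variable mu : 'I_n.+1 -> R[i].
Hypothesis mu_inj : injective mu.
Hypothesis mu_eig : forall i, eigenvalue AC (mu i).

Lemma char_poly_spectrum : char_poly AC = \prod_i ('X - (mu i)%:P).
Proof.
have := @all_roots_prod_XsubC _ (char_poly AC) [seq mu i | i <- enum 'I_n.+1].
rewrite size_char_poly size_map size_enum_ord => /(_ erefl) ->.
- by rewrite (monicP (char_poly_monic _)) scale1r big_map big_enum.
- by apply/allP => _ /mapP[i _ ->]; rewrite -eigenvalue_root_char.
- by rewrite uniq_rootsE map_inj_uniq // enum_uniq.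
Qed.

Definition evec_mx : 'M[R[i]]_n.+1 := \matrix_(k, i) mu i ^+ k.

Lemma evec_mx_unit : evec_mx \in unitmx.
Proof.
have -> : evec_mx = Vandermonde n.+1 (\row_i mu i).
  by apply/matrixP => i j; rewrite !mxE.
rewrite unitmxE det_Vandermonde unitfE; apply/prodf_neq0 => i _.
apply/prodf_neq0 => j ij.
by rewrite !mxE subr_eq0 (inj_eq mu_inj) neq_ltn ij orbT.
Qed.

Lemma companion_evec_mx : AC *m evec_mx = evec_mx *m diag_mx (\row_i mu i).
Proof.
apply/matrixP => k i; have /matrixP/(_ k 0) := companion_evec (mu_eig i).
rewrite mul_mx_diag !mxE mulrC => <-.
by apply: eq_bigr => j _; rewrite !mxE.
Qed.

(** The coordinates of the last basis vector in the eigenbasis are the residues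
    of [1 / N] at its poles. *)
Lemma evec_mx_residues :
  evec_mx *m (\col_i ((char_poly AC)^`().[mu i])^-1) = mxC (e_last R n).
Proof.
apply/colP => k; rewrite char_poly_spectrum !mxE andbT.
transitivity ((k == ord_max)%:R : R[i]); last by case: (k == _).
rewrite -(sum_roots_deriv mu_inj).
by apply: eq_bigr => i _; rewrite !mxE.
Qed.

End CompanionSpectrum.

(** * Matrix-valued functions of a real variable *)

Section MatrixCurves.
Variable R : realType.
Local Notation Re := complex.Re.

Lemma Re_mul_mxC (m n p q : nat) (L : 'M[R[i]]_(m, n)) (M : 'M[R]_(n, p))
    (K : 'M[R[i]]_(p, q)) i j w :
  Re (w * (L *m mxC M *m K) i j) =
  \sum_l \sum_k Re (w * (L i k * K l j)) * M k l.
Proof.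
rewrite mxE mulr_sumr Re_sum; apply: eq_bigr => l _.
rewrite mxE mulr_suml mulr_sumr Re_sum; apply: eq_bigr => k _.
by rewrite mxE -Re_mul_real; congr Re; ring.
Qed.

Lemma is_derive_fsum (n : nat) (h : 'I_n -> R -> R) (dh : 'I_n -> R) (x : R) :
    (forall i, is_derive x (1 : R) (h i) (dh i)) ->
  is_derive x (1 : R) (fun y => \sum_i h i y) (\sum_i dh i).
Proof.
move=> dhi; rewrite (_ : (fun y => _) = \sum_i h i); first exact: is_derive_sum.
by apply/funext => y; rewrite fct_sumE.
Qed.

Lemma is_cderive_mulmx (m n p q : nat) (L : 'M[R[i]]_(m.+1, n.+1))
    (P : R -> 'M[R]_(n.+1, p.+1)) (K : 'M[R[i]]_(p.+1, q.+1)) i j t :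
  derivable P t 1 ->
  is_cderive (fun x => (L *m mxC (P x) *m K) i j) t
    ((L *m mxC ('D_1 P t) *m K) i j).
Proof.
move=> dP w; rewrite Re_mul_mxC; under eq_fun do rewrite Re_mul_mxC.
apply: is_derive_fsum => l; apply: is_derive_fsum => k.
have dPkl : is_derive t (1 : R) (fun x => P x k l) ('D_1 P t k l).
  rewrite derive_mx // mxE; apply: DeriveDef => //.
  exact: (derivable_mxP _ _ _).1.
exact: (is_deriveZ (Re (w * (L i k * K l j))) dPkl).
Qed.

Lemma cwithin_mulmx (m n p q : nat) (L : 'M[R[i]]_(m.+1, n.+1))
    (P : R -> 'M[R]_(n.+1, p.+1)) (K : 'M[R[i]]_(p.+1, q.+1)) i j (A : set R) :
  {within A, continuous P} -> cwithin A (fun x => (L *m mxC (P x) *m K) i j).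
Proof.
move=> cP w; under eq_fun do rewrite Re_mul_mxC.
move=> x; apply: cvg_big => [|l _]; first exact: add_continuous.
apply: cvg_big => [|k _]; first exact: add_continuous.
apply: cvgMr.
exact: (cvg_comp _ _ (cP x) (@coord_continuous R _ _ k l (P x))).
Qed.

End MatrixCurves.

(** * Conjugate transpose and Hermitian part *)

Section ConjugateTranspose.
Variable R : realType.

Lemma ctrmx_mul (m p q : nat) (A : 'M[R[i]]_(m, p)) (B : 'M[R[i]]_(p, q)) :
  ctrmx (A *m B) = ctrmx B *m ctrmx A.
Proof. by rewrite /ctrmx trmx_mul map_mxM. Qed.

Lemma ctrmxK (m p : nat) (A : 'M[R[i]]_(m, p)) : ctrmx (ctrmx A) = A.
Proof. by apply/matrixP => i j; rewrite !mxE conjCK. Qed.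

Lemma ctrmxZ (m p : nat) z (A : 'M[R[i]]_(m, p)) :
  ctrmx (z *: A) = Num.conj z *: ctrmx A.
Proof. by apply/matrixP => i j; rewrite !mxE rmorphM. Qed.

Lemma ctrmx_sum (m p : nat) (J : Type) (r : seq J) (F : J -> 'M[R[i]]_(m, p)) :
  ctrmx (\sum_(k <- r) F k) = \sum_(k <- r) ctrmx (F k).
Proof.
apply/matrixP => i j; rewrite !mxE !summxE rmorph_sum.
by apply: eq_bigr => k _; rewrite !mxE.
Qed.

Lemma ctrmx_diag (m : nat) (d : 'I_m -> R[i]) :
  ctrmx (diag_mx (\row_i d i)) = diag_mx (\row_i Num.conj (d i)).
Proof.
by apply/matrixP => i j; rewrite !mxE rmorphMn /= eq_sym; case: eqP => // ->.
Qed.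

Lemma ctrmx1 (m : nat) : ctrmx (1%:M : 'M[R[i]]_m) = 1%:M.
Proof. by rewrite /ctrmx trmx1 map_mx1. Qed.

Lemma ctrmx_mxC (m p : nat) (M : 'M[R]_(m, p)) : ctrmx (mxC M) = mxC M^T.
Proof. by apply/matrixP => i j; rewrite !mxE; exact: conjc_real. Qed.

Lemma herm_part_sum (n : nat) (J : Type) (r : seq J) (F : J -> 'M[R[i]]_n.+1) :
  herm_part (\sum_(k <- r) F k) = \sum_(k <- r) herm_part (F k).
Proof. by rewrite /herm_part ctrmx_sum -big_split /= scaler_sumr. Qed.

End ConjugateTranspose.

(** * Modal decomposition of the Lyapunov solution *)

Section LyapunovModes.
Variables (R : realType) (n : nat) (a : 'I_n.+1 -> R) (lambda : 'I_n.+1 -> R[i]).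
Hypothesis lambda_inj : injective lambda.
Hypothesis lambda_eig : forall i, eigenvalue (mxC (companion a)) (lambda i).
Hypothesis lambda_sum : forall i j, lambda i + lambda j != 0.
Local Notation toC := (real_complex R).
Local Notation AC := (mxC (companion a)).
Local Notation N := (char_poly AC).
Local Notation mu := (fun i => Num.conj (lambda i)).
Local Notation x i := (evec n (lambda i)).

Lemma conj_inj : injective mu.
Proof. by move=> i j /fmorph_inj/lambda_inj. Qed.

Lemma conj_eig i : eigenvalue AC (mu i).
Proof. exact: eigenvalue_conj. Qed.

Lemma char_poly_opp_neq0 i : N.[- lambda i] != 0.
Proof.
rewrite (char_poly_spectrum lambda_inj lambda_eig) horner_prod.
apply/prodf_neq0 => j _.
by rewrite hornerXsubC -opprD oppr_eq0.
Qed.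

(** The spectrum is closed under conjugation, so [mu j] is one of the
    [lambda k]. *)
Lemma lambda_conj_neq0 i j : lambda i + mu j != 0.
Proof.
have : root N (mu j) by rewrite -eigenvalue_root_char conj_eig.
rewrite (char_poly_spectrum lambda_inj lambda_eig) rootE horner_prod.
move=> /prodf_eq0[k _].
by rewrite hornerXsubC subr_eq0 => /eqP ->; exact: lambda_sum.
Qed.

Lemma deriv_conj i : N^`().[mu i] = Num.conj (N^`().[lambda i]).
Proof.
(* [N] is factored over the conjugate roots on one side only. *)
rewrite {1}(char_poly_spectrum conj_inj conj_eig).
rewrite (char_poly_spectrum lambda_inj lambda_eig).
rewrite (deriv_prod_root mu) (deriv_prod_root lambda) !horner_prod rmorph_prod.
by apply: eq_bigr => j _; rewrite !hornerXsubC rmorphB.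
Qed.

Lemma deriv_neq0 i : N^`().[lambda i] != 0.
Proof.
by rewrite (char_poly_spectrum lambda_inj lambda_eig) deriv_prod_neq0.
Qed.

(** [Pij] before its Hermitian part is taken. *)
Definition modal_term i j t : 'M[R[i]]_n.+1 :=
  ((expK ((lambda i + mu j) * toC t) - 1) / (lambda i + mu j)) *:
     (((N^`()).[lambda i] * (N^`()).[mu j])^-1 *: (x i *m ctrmx (x j))).

Lemma ctrmx_modal_term i j t : ctrmx (modal_term i j t) = modal_term j i t.
Proof.
have conj_s : Num.conj (lambda i + mu j) = lambda j + mu i.
  by rewrite rmorphD /= conjCK addrC.
rewrite /modal_term !ctrmxZ ctrmx_mul ctrmxK; congr (_ *: (_ *: _)).
  by rewrite -conj_s -conj_expK_line fmorph_div rmorphB rmorph1.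
by rewrite fmorphV rmorphM !deriv_conj /= conjCK mulrC.
Qed.

(** Conjugate transposition exchanges [i] and [j], so the double sum is already
    Hermitian and taking Hermitian parts does not change it. *)
Lemma sum_Pij_modal_term t :
  \sum_i \sum_j Pij a lambda i j t = \sum_i \sum_j modal_term i j t.
Proof.
have -> : \sum_i \sum_j Pij a lambda i j t =
    herm_part (\sum_i \sum_j modal_term i j t).
  by rewrite herm_part_sum; apply: eq_bigr => i _; rewrite herm_part_sum.
rewrite /herm_part.
have -> : ctrmx (\sum_i \sum_j modal_term i j t) =
    \sum_i \sum_j modal_term i j t.
  rewrite ctrmx_sum exchange_big /=; apply: eq_bigr => i _.
  by rewrite ctrmx_sum; apply: eq_bigr => j _; rewrite ctrmx_modal_term.
by rewrite scalerDr -scalerDl -div1r -splitr scale1r.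
Qed.

(** Entry [k] is the partial fraction expansion of [s^k / N(s)] over the roots
    [mu j], evaluated at [s = - lambda i]; the signs coming from
    [(- lambda i)^k] and from [- lambda i - mu j] make up [Jmx]. *)
Lemma residue_row i :
  \sum_j ((lambda i + mu j) * N^`().[mu j])^-1 *: ctrmx (x j) =
  N.[- lambda i]^-1 *: ((x i)^T *m Jmx R n).
Proof.
apply/rowP => k; rewrite summxE mxE /Jmx mul_mx_diag !mxE.
have := @partial_fractions _ _ _ conj_inj 'X^k (- lambda i).
rewrite -(char_poly_spectrum conj_inj conj_eig) size_polyXn ltn_ord => /(_ isT).
rewrite char_poly_opp_neq0 => /(_ isT); rewrite hornerXn => E.
have -> : lambda i ^+ k * (-1) ^+ k.+1 = - (- lambda i) ^+ k.
  by rewrite exprS mulN1r mulrN (exprNn (lambda i)) mulrC.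
rewrite mulrN mulrC E -sumrN; apply: eq_bigr => j _.
rewrite !mxE hornerXn rmorphXn -opprD mulrN invrN mulrN opprK.
by rewrite [in RHS]mulrC (mulrC N^`().[_]).
Qed.

(** The row [(x i)^T *m Jmx / N(- lambda i)] is expanded in the rows
    [ctrmx (x j)] by [residue_row]; these are left eigenvectors of [ctrmx AC],
    so the matrix exponential acts on each as a scalar exponential. *)
Lemma Ptilde_sum i t : Ptilde a lambda i t = \sum_j Pij a lambda i j t.
Proof.
rewrite -herm_part_sum /Ptilde; congr herm_part.
set E := expmx _.
pose V := ctrmx (evec_mx lambda).
have Vrow j : row j V = ctrmx (x j).
  by apply/rowP => k; rewrite !mxE.
have VE : V *m E = diag_mx (\row_j expK ((lambda i + mu j) * toC t)) *m V.
  apply: expmx_diag.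
  - by rewrite /V /ctrmx map_unitmx unitmx_tr evec_mx_unit.
  - have VA : V *m ctrmx AC = diag_mx (\row_j mu j) *m V.
      rewrite -ctrmx_mul companion_evec_mx // ctrmx_mul; congr (_ *m _).
      exact: ctrmx_diag.
    rewrite -scalemxAr mulmxDr VA; apply/matrixP => k l.
    rewrite mul_mx_scalar !mul_diag_mx !mxE; ring.
  - by move=> j; exact: (expK_line _ t).1.
have xE j : ctrmx (x j) *m (1%:M - E) =
    (1 - expK ((lambda i + mu j) * toC t)) *: ctrmx (x j).
  rewrite mulmxBr mulmx1 scalerBl scale1r -Vrow -row_mul VE; congr (_ - _).
  by apply/rowP => k; rewrite mxE mul_diag_mx !mxE.
have -> : (N^`().[lambda i] * N.[- lambda i])^-1 *: (x i *m (x i)^T *m Jmx R n) =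
    N^`().[lambda i]^-1 *: (x i *m
       \sum_j ((lambda i + mu j) * N^`().[mu j])^-1 *: ctrmx (x j)).
  by rewrite residue_row -scalemxAr scalerA invfM mulmxA.
rewrite mulNmx -scalemxAl -mulmxA mulmx_suml mulmx_sumr scaler_sumr -sumrN.
apply: eq_bigr => j _; rewrite -scalemxAl xE -!scalemxAr !scalerA -scaleNr.
congr (_ *: _).
have := deriv_neq0 i; have := lambda_conj_neq0 i j.
have : N^`().[mu j] != 0 by rewrite deriv_conj fmorph_eq0 deriv_neq0.
set d := N^`().[mu j]; set s := lambda i + _ => d0 s0 d'0.
field.
by rewrite d0 s0 d'0.
Qed.

(** In the eigenbasis the Lyapunov equation decouples: each entry of [G] solves
    a scalar equation of rate [lambda i + mu j], whose only solution vanishing at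
    0 is explicit. *)
Lemma DLE_modes (I : interval R) (P : R -> 'M[R]_n.+1) t :
    0 \in I -> solves_DLE (companion a) (e_last R n) I P -> t \in I ->
  mxC (P t) = \sum_i \sum_j modal_term i j t.
Proof.
move=> I0 [P0 cP dP] tI.
pose X := evec_mx lambda; pose Y := invmx X.
have Xu : X \in unitmx by exact: evec_mx_unit.
pose G u := Y *m mxC (P u) *m ctrmx Y.
have YA : Y *m AC = diag_mx (\row_i lambda i) *m Y.
  apply: (can_inj (mulmxK Xu)); rewrite -mulmxA companion_evec_mx //.
  by rewrite mulmxA mulVmx // mul1mx mulmxKV.
have Ye : Y *m mxC (e_last R n) = \col_i (N^`().[lambda i])^-1.
  by rewrite -(evec_mx_residues lambda_inj lambda_eig) mulKmx.
have GE i j : G t i j =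
    (expK ((lambda i + mu j) * toC t) - 1) / (lambda i + mu j) *
    (N^`().[lambda i] * N^`().[mu j])^-1.
  apply: (@affine_ode R I (fun u => G u i j) _ _ (lambda_conj_neq0 i j) I0
    _ _ _ t tI).
  - by rewrite /G P0 /mxC map_mx0 mulmx0 mul0mx mxE.
  - exact: cwithin_mulmx.
  - move=> u /dP[dPu DLE].
    have D1 : mxC ('D_1 P u) = AC *m mxC (P u) + mxC (P u) *m ctrmx AC
        + mxC (e_last R n) *m ctrmx (mxC (e_last R n)).
      have -> : 'D_1 P u = companion a *m P u + P u *m (companion a)^T
          + e_last R n *m (e_last R n)^T.
        by apply: (addrI (- 'D_1 P u)); rewrite addNr !addrA DLE addNr.
      by rewrite !ctrmx_mxC /mxC !map_mxD !map_mxM.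
    have -> : (lambda i + mu j) * G u i j +
        (N^`().[lambda i] * N^`().[mu j])^-1 =
        (Y *m mxC ('D_1 P u) *m ctrmx Y) i j; last exact: is_cderive_mulmx.
    rewrite D1 !mulmxDr !mulmxDl.
    have -> : Y *m (AC *m mxC (P u)) *m ctrmx Y =
        diag_mx (\row_i lambda i) *m G u.
      by rewrite /G !mulmxA YA.
    have -> : Y *m (mxC (P u) *m ctrmx AC) *m ctrmx Y =
        G u *m ctrmx (diag_mx (\row_i lambda i)).
      by rewrite /G -!mulmxA -!ctrmx_mul YA.
    have -> : Y *m (mxC (e_last R n) *m ctrmx (mxC (e_last R n))) *m ctrmx Y =
        (\col_i (N^`().[lambda i])^-1) *m
        ctrmx (\col_i (N^`().[lambda i])^-1).
      by rewrite !mulmxA -mulmxA -ctrmx_mul Ye.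
    rewrite ctrmx_diag mul_mx_diag mul_diag_mx !mxE big_ord1 !mxE.
    by rewrite invfM deriv_conj fmorphV; ring.
have -> : mxC (P t) = X *m G t *m ctrmx X.
  rewrite /G !mulmxA mulmxV // mul1mx -mulmxA -ctrmx_mul mulmxV //.
  by rewrite ctrmx1 mulmx1.
rewrite [RHS]exchange_big /=; apply/matrixP => k l; rewrite mxE summxE.
apply: eq_bigr => j _; rewrite mxE mulr_suml summxE; apply: eq_bigr => i _.
rewrite GE /modal_term !mxE big_ord1 !mxE; ring.
Qed.

End LyapunovModes.

Theorem theorem2 (R : realType) (n : nat) (a : 'I_n.+1 -> R)
    (lambda : 'I_n.+1 -> R[i])
    (lambda_inj : injective lambda)
    (lambda_eig : forall i, eigenvalue (mxC (companion a)) (lambda i))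
    (lambda_sum : forall i j, lambda i + lambda j != 0)
    (I : interval R) (I0 : 0 \in I) (P : R -> 'M[R]_n.+1)
    (P_sol : solves_DLE (companion a) (e_last R n) I P)
    (t : R) (tI : t \in I) :
  [/\ mxC (P t) = \sum_(i < n.+1) Ptilde a lambda i t,
      mxC (P t) = \sum_(i < n.+1) \sum_(j < n.+1) Pij a lambda i j t &
      forall i, Ptilde a lambda i t = \sum_(j < n.+1) Pij a lambda i j t].
Proof.
have PtE := Ptilde_sum lambda_inj lambda_eig lambda_sum.
have PE : mxC (P t) = \sum_i \sum_j Pij a lambda i j t.
  rewrite (sum_Pij_modal_term lambda_inj lambda_eig).
  exact: (DLE_modes lambda_inj lambda_eig lambda_sum I0 P_sol tI).
split=> //.
by rewrite PE; apply: eq_bigr => i _; rewrite PtE.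
Qed.
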